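(* Let $X$ be a non-sub-Gaussian real random variable, i.e. either $\mathbb{E}e^{\lambda X}=\infty$ for some $\lambda\in\mathbb{R}$, or for any $\xi^2>0$ there exists $\lambda\in\mathbb{R}$ such that $\mathbb{E}e^{\lambda X}>e^{\lambda^2\xi^2/2}$. Let $X_1,\ldots,X_n$ be i.i.d. copies of $X$. If $C_n\to\infty$, then $\hat\xi_n^2\to\infty$ almost surely as $n\to\infty$.
   Context: A random variable $X$ is called sub-Gaussian if there exists $\xi^2>0$ such that $\mathbb{E}[e^{\lambda X}]\le e^{\lambda^2\xi^2/2}$ for all $\lambda\in\mathbb{R}$. Given $X_1,\dots,X_n$ with sample mean $\bar X=\frac1n\sum_{i=1}^nX_i$, let $L_n(\lambda)=\frac{2}{\lambda^2}\log\bigl\{\frac1n\sum_{i=1}^n e^{\lambda(X_i-\bar X)}\bigr\}$ for $\lambda\neq 0$ and $L_n(0)=\frac1n\sum_{i=1}^n(X_i-\bar X)^2$. The estimator is $\hat\xi_n^2=\sup_{|\lambda|\le C_n}L_n(\lambda)$, where $C_n>0$ is a sequence of truncation levels.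
   Formalization: If E X ≠ 0, it is also assumed that X − E X is non-sub-Gaussian (X itself if the mean is not finite); without this the claim fails, e.g. X = 1 is non-sub-Gaussian as defined but the estimator is 0. *)

(* Defs.v *)
From HB Require Import structures.
From mathcomp Require Import all_boot all_order all_algebra finmap.
From mathcomp Require Import all_classical all_reals all_analysis.
Set Implicit Arguments.
Unset Strict Implicit.
Unset Printing Implicit Defensive.
Import Order.TTheory GRing.Theory Num.Theory.
Import numFieldNormedType.Exports.
Local Open Scope classical_set_scope.
Local Open Scope ring_scope.

Definition sub_gaussian d (T : measurableType d) (R : realType)
    (P : probability T R) (X : T -> R) : Prop :=
  exists2 xi2 : R, 0 < xi2 &
    forall lambda : R, ('M_P X lambda <= (expR (lambda ^+ 2 * xi2 / 2))%:E)%E.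

Definition non_sub_gaussian d (T : measurableType d) (R : realType)
    (P : probability T R) (X : T -> R) : Prop :=
  (exists lambda : R, 'M_P X lambda = +oo%E) \/
  (forall xi2 : R, 0 < xi2 ->
     exists lambda : R, ((expR (lambda ^+ 2 * xi2 / 2))%:E < 'M_P X lambda)%E).

Lemma non_sub_gaussianP d (T : measurableType d) (R : realType)
    (P : probability T R) (X : T -> R) :
  non_sub_gaussian P X <-> ~ sub_gaussian P X.
Proof.
split=> [[[l Ml]|h] [xi2 xi20 sg]|nsg].
- by have := sg l; rewrite Ml leye_eq.
- by have [l] := h _ xi20; rewrite ltNge sg.
- right=> xi2 xi20; apply: contrapT => nex; apply: nsg; exists xi2 => // l.
  by rewrite leNgt; apply/negP => lt; apply: nex; exists l.
Qed.

(* The expectation need not exist: if 'E_P[X] is not finite (in particular if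
   X is not integrable), then fine 'E_P[X] = 0 and X is left unchanged. *)
Definition centered d (T : measurableType d) (R : realType)
    (P : probability T R) (X : T -> R) : T -> R :=
  X \- cst (fine ('E_P[X])%E).

Definition mutually_independent d (T : measurableType d) (R : realType)
    (P : probability T R) (X : nat -> {RV P >-> R}) : Prop :=
  forall (J : {fset nat}) (A : nat -> set R),
    (forall i, measurable (A i)) ->
    P (\bigcap_(i in [set` J]) (X i @^-1` A i)) =
    (\prod_(i <- J) P (X i @^-1` A i))%E.

Definition same_distribution d d' (T : measurableType d)
    (T' : measurableType d') (R : realType) (P : probability T R)
    (P' : probability T' R) (X : {RV P >-> R}) (Y : {RV P' >-> R}) : Prop :=
  forall A : set R, measurable A -> distribution P X A = distribution P' Y A.

Definition iid_copies d d' (T : measurableType d)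
    (T' : measurableType d') (R : realType) (P : probability T R)
    (P' : probability T' R) (Xs : nat -> {RV P >-> R}) (X : {RV P' >-> R}) :
    Prop :=
  mutually_independent Xs /\ forall i, same_distribution (Xs i) X.

(* The observations X_1, ..., X_n are x 0, ..., x n.-1. *)
Definition sample_mean (R : realType) (n : nat) (x : nat -> R) : R :=
  n%:R^-1 * \sum_(i < n) x i.

Definition Ln (R : realType) (n : nat) (x : nat -> R) (lambda : R) : R :=
  if lambda == 0 then n%:R^-1 * \sum_(i < n) (x i - sample_mean n x) ^+ 2
  else 2 / lambda ^+ 2 *
       ln (n%:R^-1 * \sum_(i < n) expR (lambda * (x i - sample_mean n x))).

(* The supremum is taken in the extended reals, so that no junk value of the
   real-valued sup can interfere. *)
Definition xi2_hat (R : realType) (c : R) (n : nat) (x : nat -> R) : \bar R :=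
  ereal_sup [set (Ln n x lambda)%:E | lambda in [set l : R | `|l| <= c]].

(* Main.v *)
Require Import Defs.
From HB Require Import structures.
From mathcomp Require Import all_boot all_order all_algebra finmap ring lra.
From mathcomp Require Import all_classical all_reals all_analysis.
From mathcomp Require Import measurable_realfun.
Set Implicit Arguments.
Unset Strict Implicit.
Unset Printing Implicit Defensive.
Import Order.TTheory GRing.Theory Num.Theory.
Import numFieldNormedType.Exports.
Local Open Scope classical_set_scope.
Local Open Scope ring_scope.

(* Choose one lambda and bound the supremum from below by Ln lambda.

   If E X^2 is infinite, lambda = 0 works: the sample variance blows up. A fixed
   positive proportion of the sample lies in some [-a, a], so the mean square
   deviation of the sample about m is large as soon as |m| is; and for bounded m
   it is large because the empirical second moment is.

   If E X^2 is finite, the sample mean converges to E X. As X - E X is not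
   sub-Gaussian, some lambda != 0 satisfies
   E exp (lambda (X - E X)) > exp (lambda^2 B / 2), and then Ln lambda > B
   eventually.

   Both cases use the strong law only for nonnegative square-integrable
   variables and, by truncation, its one-sided form for nonnegative variables of
   possibly infinite mean. *)

(** * Second moments of sums of uncorrelated variables *)

Lemma measurable_sqr_Lfun2 d (T : measurableType d) (R : realType)
    (P : probability T R) (f : T -> R) :
  measurable_fun setT f -> (\int[P]_w ((f w) ^+ 2)%:E < +oo)%E ->
  f \in Lfun P 2%:E.
Proof.
move=> mf foo; rewrite inE/=; apply/andP; split; rewrite inE//=.
rewrite /finite_norm unlock /Lnorm.
rewrite poweR_lty//; apply: le_lt_trans foo.
rewrite le_eqVlt; apply/orP; left; apply/eqP; apply: eq_integral => w _ /=.
by rewrite powR_mulrn// real_normK ?num_real.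
Qed.

Lemma covariance_suml_eq0 d (T : measurableType d) (R : realType)
    (P : probability T R) (Y : nat -> T -> R) (Z : T -> R) (n : nat) :
    (forall i, Y i \in Lfun P 2%:E) -> Z \in Lfun P 2%:E ->
    (forall i, (i < n)%N -> covariance P (Y i) Z = 0%E) ->
  covariance P (\sum_(i < n) Y i) Z = 0%E.
Proof.
move=> Y2 Z2; elim: n => [|n IHn] YZ0.
  by rewrite big_ord0 -[0]/(cst 0) covariance_cst_l.
rewrite big_ord_recr/= covarianceDl//.
- by rewrite IHn ?YZ0 ?adde0// => i ni; apply: YZ0; exact: ltnW.
- by rewrite rpred_sum// lee1n.
Qed.

Lemma variance_sum_uncorrelated d (T : measurableType d) (R : realType)
    (P : probability T R) (Y : nat -> T -> R) (v : R) (n : nat) :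
    (forall i, Y i \in Lfun P 2%:E) -> (forall i, 'V_P[Y i] = v%:E) ->
    (forall i j, i != j -> covariance P (Y i) (Y j) = 0%E) ->
  'V_P[\sum_(i < n) Y i] = (n%:R * v)%:E.
Proof.
move=> Y2 Yv Y0; elim: n => [|n IHn].
  by rewrite big_ord0 -[0]/(cst 0) variance_cst mul0r.
rewrite big_ord_recr/= varianceD//; last by rewrite rpred_sum// lee1n.
rewrite covariance_suml_eq0 ?mule0 ?adde0//; last first.
  by move=> i ni; rewrite Y0// ltn_eqF.
by rewrite IHn Yv -EFinD -natr1 mulrDl mul1r.
Qed.

(** The mean of the [Y i] has expectation m, so the integral is its variance, n^-2 * (n v). *)
Lemma expectation_sqr_mean_dev d (T : measurableType d) (R : realType)
    (P : probability T R) (Y : nat -> T -> R) (m v : R) (n : nat) :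
    (forall i, Y i \in Lfun P 2%:E) -> (forall i, 'E_P[Y i] = m%:E)%E ->
    (forall i, 'V_P[Y i] = v%:E) ->
    (forall i j, i != j -> covariance P (Y i) (Y j) = 0%E) -> (0 < n)%N ->
  (\int[P]_w ((n%:R^-1 * \sum_(i < n) Y i w - m) ^+ 2)%:E = (v / n%:R)%:E)%E.
Proof.
move=> Y2 Ym Yv Y0 n0.
have Pfin : P setT \is a fin_num := fin_num_measure P _ measurableT.
have Y1 i := Lfun_subset12 Pfin (Y2 i).
have S2 : (\sum_(i < n) Y i) \in Lfun P 2%:E by rewrite rpred_sum// lee1n.
have S1 := Lfun_subset12 Pfin S2.
have n00 : n%:R != 0 :> R by rewrite pnatr_eq0 -lt0n.
have ES k : ('E_P[(\sum_(i < k) Y i)%R] = (k%:R * m)%:E)%E.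
  elim: k => [|k IHk]; first by rewrite big_ord0 expectation_cst mul0r.
  rewrite big_ord_recr/= expectationD ?rpred_sum//.
  by rewrite IHk Ym -EFinD -natr1 mulrDl mul1r.
have : ('V_P[(n%:R^-1 \o* \sum_(i < n) Y i)%R] = (v / n%:R)%:E)%E.
  rewrite varianceZ// (@variance_sum_uncorrelated _ _ _ _ _ v)// -EFinM.
  by congr EFin; field.
rewrite /variance covariance.unlock expectationZl// ES/= mulKf// unlock => <-.
by apply: eq_integral => w _; rewrite fct_sumE expr2 [n%:R^-1 * _]mulrC.
Qed.

(** * Strong law for nonnegative uncorrelated variables *)

Lemma sqr_bracket (n : nat) : exists k, (k ^ 2 <= n < k.+1 ^ 2)%N.
Proof.
elim: n => [|n [k /andP[kn nk]]]; first by exists 0%N.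
have [nk'|nk'] := ltnP n.+1 (k.+1 ^ 2); first by exists k; rewrite nk' ltnW.
by exists k.+1; rewrite nk' (leq_ltn_trans nk)// ltn_exp2r.
Qed.

(** Between consecutive squares, monotonicity squeezes S n between its values at the two squares,
    whose ratio tends to 1. *)
Lemma cvg_mean_along_squares (R : realType) (S : nat -> R) (m : R) :
    0 <= m -> {homo S : i j / (i <= j)%N >-> i <= j} ->
    ((k.+1 ^ 2)%:R^-1 * S (k.+1 ^ 2)%N) @[k --> \oo] --> m ->
  (n%:R^-1 * S n) @[n --> \oo] --> m.
Proof.
move=> m0 Snd /cvgrPdist_le Sm; apply/cvgrPdist_le => e e0.
(* With a = k + 1, the deviation at (a + 1)^2 costs e' (a + 1)^2 <= 4 e' a^2. Passing from one
   square to the next costs m (2 a + 1) <= 3 m a <= 2 e' a^2 once k > 2 m / e'. Together this is 6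
   e' a^2. *)
pose e' := e / 6; have e'0 : 0 < e' by rewrite divr_gt0.
have [N1 _ SN1] := Sm _ e'0.
have [N2 _ SN2] := nbhs_infty_gtr (2 * m / e').
pose N := maxn N1 N2; exists (N.+1 ^ 2)%N => //= n Nn.
(* A zero root would force n = 0, which is below the threshold. Otherwise the root is renamed k + 1,
   so that (k + 1)^2 <= n < (k + 2)^2. *)
have [[|k] /andP[kn nk]] := sqr_bracket n.
  by move: (leq_trans (expn_gt0 N.+1 2) Nn); rewrite lt0n; case: n nk {Nn kn}.
have Nk : (N <= k)%N.
  suff : (N.+1 < k.+2)%N by [].
  by rewrite -(ltn_exp2r _ _ (isT : 0 < 2)%N) (leq_ltn_trans Nn nk).
have N1k : (N1 <= k)%N := leq_trans (leq_maxl _ _) Nk.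
have N2k : (N2 <= k)%N := leq_trans (leq_maxr _ _) Nk.
have := SN2 _ N2k; rewrite /= ltr_pdivrMr// => mk.
have /= := SN1 _ N1k; have /= := SN1 _ (leqW N1k).
rewrite !natrX.
have S1 := Snd _ _ kn; have S2 := Snd _ _ (ltnW nk).
have a1 : 1 <= k.+1%:R :> R by rewrite ler1n.
have xa : k.+1%:R ^+ 2 <= n%:R :> R by rewrite -natrX ler_nat.
have xb : n%:R <= k.+2%:R ^+ 2 :> R by rewrite -natrX ler_nat ltnW.
have n0 : 0 < n%:R :> R by apply: lt_le_trans xa; rewrite exprn_gt0// ltr0n.
have k2E : k.+2%:R = k.+1%:R + 1 :> R by rewrite -natr1.
move: mk xb; rewrite k2E.
have -> : k%:R = k.+1%:R - 1 :> R by rewrite -natr1 addrK.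
move: (k.+1%:R : R) a1 xa (S (k.+1 ^ 2)%N) (S (k.+2 ^ 2)%N) S1 S2.
move=> a a1 xa Sa Sb SaSn SnSb mk xb.
have a0 : 0 < a by lra.
have a20 : 0 < a ^+ 2 by rewrite exprn_gt0.
have b20 : 0 < (a + 1) ^+ 2 by rewrite exprn_gt0// addr_gt0.
have dist (x s d : R) : 0 < x ->
    (`|m - x^-1 * s| <= d) = (m * x - d * x <= s <= m * x + d * x).
  move=> x0; rewrite distrC ler_distl [_^-1 * _]mulrC.
  by rewrite ler_pdivlMr// ler_pdivrMr// mulrBl mulrDl.
rewrite !dist// => /andP[_ Sb1] /andP[Sa1 _].
have eE : e = 6 * e' by rewrite /e'; field.
rewrite eE in e0 *; move: e' e'0 mk Sb1 Sa1 {eE SN1 SN2 e0}.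
move=> e' e'0 mk Sb1 Sa1.
have ma : 2 * (m * a) <= e' * a ^+ 2 by nra.
have mx : m * n%:R <= m * (a + 1) ^+ 2 by rewrite ler_wpM2l.
have mx' : m * a ^+ 2 <= m * n%:R by rewrite ler_wpM2l.
have ex : e' * a ^+ 2 <= e' * n%:R by rewrite ler_pM2l.
have mm : m <= m * a by rewrite ler_peMr.
have ea : e' * (a + 1) ^+ 2 <= 4 * (e' * a ^+ 2).
  by rewrite [leRHS]mulrCA ler_pM2l//; nra.
by apply/andP; split; nra.
Qed.

(** By monotone convergence the series of the f k has a finite integral, hence is finite almost
    everywhere, and the terms of a convergent series tend to 0. *)
Lemma ae_cvg0_summable_integral d (T : measurableType d) (R : realType)
    (P : {measure set T -> \bar R}) (f : nat -> T -> R) :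
    (forall k, measurable_fun setT (f k)) -> (forall k w, 0 <= f k w) ->
    (\sum_(0 <= k <oo) \int[P]_w (f k w)%:E < +oo)%E ->
  {ae P, forall w, f k w @[k --> \oo] --> (0 : R)}.
Proof.
move=> mf f0 foo.
pose F w := (\sum_(0 <= k <oo) (f k w)%:E)%E.
have mfE k : measurable_fun setT (EFin \o f k) by exact/measurable_EFinP.
have F0 w : (0 <= F w)%E by apply: nneseries_ge0 => k _ _; rewrite lee_fin.
have iF : P.-integrable setT F.
  apply/integrableP; split.
    apply: (@ge0_emeasurable_sum _ _ _ setT (fun k w => (f k w)%:E) xpredT)
      => //.
      by move=> k w _ _; rewrite lee_fin.
    by move=> k _; exact: mfE.
  rewrite (@eq_integral _ _ _ P setT F); last first.
    by move=> w _ /=; rewrite gee0_abs.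
  by rewrite integral_nneseries// => k w _; rewrite lee_fin.
apply: filterS (integrable_ae measurableT iF) => w /(_ I).
rewrite ge0_fin_numE// => Fw.
by apply: cvg_series_cvg_0; exact: nnseries_is_cvg.
Qed.

Lemma sum_inv_squares_le2 (R : realType) (n : nat) :
  \sum_(0 <= k < n) (k.+1 ^ 2)%:R^-1 <= 2 :> R.
Proof.
(* The stronger bound telescopes, since 1/(n + 1)^2 <= 1/n - 1/(n + 1) for n > 0. At n = 0 the
   inverse is 0 by convention, so the step from 0 to 1 is checked apart. *)
suff : \sum_(0 <= k < n) (k.+1 ^ 2)%:R^-1 <= 2 - n%:R^-1 :> R.
  by move=> /le_trans; apply; rewrite gerBl.
elim: n => [|n IHn]; first by rewrite big_geq// invr0 subr0.
rewrite big_nat_recr//=; case: n IHn => [_|n IHn].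
  by rewrite big_geq// add0r exp1n invr1; lra.
apply: (le_trans (lerD IHn (lexx _))).
rewrite natrX -[n.+2%:R]natr1; set a : R := n.+1%:R.
have a0 : 0 < a by rewrite ltr0n.
have a10 : 0 < a + 1 by rewrite addr_gt0.
have -> : 2 - (a + 1)^-1 = (2 - a^-1) + (a * (a + 1))^-1.
  by field; rewrite ?gt_eqF.
by rewrite lerD2l lef_pV2 ?posrE ?mulr_gt0 ?exprn_gt0//; nra.
Qed.

(* Etemadi's argument: along the squares the mean square deviations are
   summable, and monotonicity of the partial sums controls what is in between. *)
Lemma strong_law_uncorrelated d (T : measurableType d) (R : realType)
    (P : probability T R) (Y : nat -> T -> R) (m v : R) :
    (forall i, Y i \in Lfun P 2%:E) -> (forall i, 'E_P[Y i] = m%:E)%E ->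
    (forall i, 'V_P[Y i] = v%:E) ->
    (forall i j, i != j -> covariance P (Y i) (Y j) = 0%E) ->
    (forall i w, 0 <= Y i w) ->
  {ae P, forall w, n%:R^-1 * (\sum_(i < n) Y i w) @[n --> \oo] --> m}.
Proof.
move=> Y2 Ym Yv Ycov Y0.
have mY i : measurable_fun setT (Y i).
  by have := sub_Lfun_mfun (Y2 i); rewrite inE.
have m0 : 0 <= m by rewrite -lee_fin -(Ym 0%N) expectation_ge0.
have v0 : 0 <= v by rewrite -lee_fin -(Yv 0%N) variance_ge0.
pose K k := (k.+1 ^ 2)%N.
pose D k w := ((K k)%:R^-1 * (\sum_(i < K k) Y i w) - m) ^+ 2.
have intD k : (\int[P]_w (D k w)%:E = (v / (K k)%:R)%:E)%E.
  by apply: expectation_sqr_mean_dev => //; rewrite expn_gt0.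
have aeD : {ae P, forall w, D k w @[k --> \oo] --> (0 : R)}.
  apply: ae_cvg0_summable_integral => [k|k w|]; last 2 first.
  - exact: sqr_ge0.
  - apply: (@le_lt_trans _ _ (v * 2)%:E); last exact: ltry.
    apply: lime_le.
      apply: is_cvg_nneseries => k _ _; apply: integral_ge0 => w _.
      by rewrite lee_fin sqr_ge0.
    apply: nearW => n; under eq_bigr do rewrite intD.
    by rewrite sumEFin lee_fin -mulr_sumr ler_wpM2l// sum_inv_squares_le2.
  - apply: measurable_funX; apply: measurable_funB => //.
    by apply: measurable_funM => //; exact: measurable_sum.
apply: filterS aeD => w Dw.
apply: (@cvg_mean_along_squares _ (fun n => \sum_(i < n) Y i w)) => //.
  move=> i j ij; rewrite -!(big_mkord xpredT (Y ^~ w)).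
  by rewrite (big_cat_nat (leq0n i) ij)//= lerDl sumr_ge0.
apply/cvgrPdist_le => e e0; have e20 : 0 < e ^+ 2 by rewrite exprn_gt0.
move/cvgrPdist_le : Dw => /(_ _ e20); apply: filterS => k.
rewrite sub0r normrN ger0_norm ?sqr_ge0// distrC /D -(real_normK (num_real _)).
by rewrite ler_pXn2r// nnegrE ltW.
Qed.

(** * Strong law for square-integrable functions of i.i.d. variables *)

Lemma same_distribution_integral d d' (T : measurableType d)
    (T' : measurableType d') (R : realType) (P : probability T R)
    (P' : probability T' R) (X : {RV P >-> R}) (Y : {RV P' >-> R})
    (h : R -> R) :
    same_distribution X Y -> measurable_fun setT h -> (forall x, 0 <= h x) ->
  (\int[P]_w (h (X w))%:E = \int[P']_w (h (Y w))%:E)%E.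
Proof.
move=> XY mh h0.
have mhE : measurable_fun setT (EFin \o h) by exact/measurable_EFinP.
have hE0 y : (0 <= (EFin \o h) y)%E by rewrite lee_fin.
rewrite -(ge0_integral_distribution X mhE hE0).
rewrite -(ge0_integral_distribution Y mhE hE0).
by apply: eq_measure_integral => A mA _; exact: XY.
Qed.

Lemma mutually_independent_pair d (T : measurableType d) (R : realType)
    (P : probability T R) (X : nat -> {RV P >-> R}) (i j : nat) (A B : set R) :
    mutually_independent X -> i != j -> measurable A -> measurable B ->
  (P ((X i @^-1` A) `&` (X j @^-1` B)) =
   P (X i @^-1` A) * P (X j @^-1` B))%E.
Proof.
move=> indX ij mA mB.
(* Independence is stated for families over all indices; only the values at i and j enter below. *)
pose F k := if k == i then A else B.
have mF k : measurable (F k) by rewrite /F; case: ifP.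
have Fi : F i = A by rewrite /F eqxx.
have Fj : F j = B by rewrite /F eq_sym (negPf ij).
have := indX [fset i; j]%fset F mF.
rewrite big_fsetU1/=; last by rewrite inE.
rewrite big_seq_fset1 Fi Fj => <-; congr (P _).
apply/seteqP; split=> w /=.
  by move=> [Ai Bj] k /=; rewrite !inE => /orP[] /eqP ->; rewrite ?Fi ?Fj.
move=> w_; split.
  by have := w_ i; rewrite /= Fi; apply; rewrite !inE eqxx.
by have := w_ j; rewrite /= Fj; apply; rewrite !inE eqxx orbT.
Qed.

(** The law of the pair agrees with the product of the two laws on rectangles, hence everywhere, and
    Tonelli splits the integral. Nonnegativity makes integrability unnecessary. *)
Lemma integral_mul_indep d (T : measurableType d) (R : realType)
    (P : probability T R) (U V : {RV P >-> R}) (f g : R -> R) :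
    (forall A B, measurable A -> measurable B ->
       P ((U @^-1` A) `&` (V @^-1` B)) = P (U @^-1` A) * P (V @^-1` B))%E ->
    measurable_fun setT f -> measurable_fun setT g ->
    (forall x, 0 <= f x) -> (forall x, 0 <= g x) ->
  (\int[P]_w (f (U w) * g (V w))%:E =
   \int[P]_w (f (U w))%:E * \int[P]_w (g (V w))%:E)%E.
Proof.
move=> ind mf mg f0 g0.
pose UV w := (U w, V w).
have mUV : measurable_fun setT UV by exact: measurable_fun_pair.
pose h (z : R * R) : \bar R := (f z.1 * g z.2)%:E.
have mh : measurable_fun setT h.
  apply/measurable_EFinP; apply: measurable_funM.
  - by apply: measurableT_comp => //; exact: measurable_fst.
  - by apply: measurableT_comp => //; exact: measurable_snd.
have h0 z : (0 <= h z)%E by rewrite lee_fin mulr_ge0.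
have mfE : measurable_fun setT (EFin \o f) by exact/measurable_EFinP.
have mgE : measurable_fun setT (EFin \o g) by exact/measurable_EFinP.
have fE0 y : (0 <= (EFin \o f) y)%E by rewrite lee_fin.
have gE0 y : (0 <= (EFin \o g) y)%E by rewrite lee_fin.
transitivity (\int[pushforward P UV]_z h z)%E.
  by rewrite ge0_integral_pushforward.
transitivity (\int[(distribution P U \x distribution P V)%E]_z h z)%E.
  apply: eq_measure_integral => A mA _; apply/esym.
  exact: (@product_measure_unique _ _ _ _ _ _ _ (pushforward P UV)).
rewrite fubini_tonelli1//.
transitivity (\int[distribution P U]_x
    ((EFin \o f) x * \int[distribution P V]_y (EFin \o g) y))%E.
  apply: eq_integral => x _.
  by rewrite /fubini_F/= /h/= -ge0_integralZl ?lee_fin// => y _; rewrite lee_fin.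
rewrite ge0_integralZr//; last exact: integral_ge0.
by rewrite -[RHS]/((\int[P]_w ((EFin \o f) \o U) w) *
  (\int[P]_w ((EFin \o g) \o V) w))%E !ge0_integral_distribution.
Qed.

(** Equality in law gives the [g (Xs i)] a common mean and variance; independence enters only
    through the vanishing of pairwise covariances. *)
Lemma strong_law_iid_sqr d d' (T : measurableType d)
    (T' : measurableType d') (R : realType) (P : probability T R)
    (P' : probability T' R) (Xs : nat -> {RV P >-> R}) (X : {RV P' >-> R})
    (g : R -> R) :
    iid_copies Xs X -> measurable_fun setT g -> (forall x, 0 <= g x) ->
    (\int[P']_w ((g (X w)) ^+ 2)%:E < +oo)%E ->
  {ae P, forall w, n%:R^-1 * (\sum_(i < n) g (Xs i w)) @[n --> \oo] -->
    fine (\int[P']_w (g (X w))%:E)%E}.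
Proof.
move=> [indX sameX] mg g0 g2.
pose Y i : T -> R := g \o Xs i.
have mg2 : measurable_fun setT (fun x => g x ^+ 2) by exact: measurable_funX.
have g20 x : 0 <= g x ^+ 2 by exact: sqr_ge0.
have Y2 i : Y i \in Lfun P 2%:E.
  apply: measurable_sqr_Lfun2; first exact: measurableT_comp.
  by rewrite (same_distribution_integral (sameX i) mg2 g20).
have Y1 i := Lfun_subset12 (fin_num_measure P _ measurableT) (Y2 i).
have EY i : ('E_P[Y i] = \int[P']_w (g (X w))%:E)%E.
  by rewrite unlock (same_distribution_integral (sameX i) mg g0).
have EY2 i : ('E_P[(Y i ^+ 2)%R] = \int[P']_w ((g (X w)) ^+ 2)%:E)%E.
  by rewrite unlock -(same_distribution_integral (sameX i) mg2 g20).
have VY i : 'V_P[Y i] = 'V_P[Y 0%N] by rewrite !varianceE// !EY !EY2.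
apply: (@strong_law_uncorrelated _ _ _ _ Y _ (fine 'V_P[Y 0%N])) => //.
- by move=> i; rewrite -(EY 0%N) fineK ?expectation_fin_num// !EY.
- by move=> i; rewrite VY fineK ?variance_fin_num.
- move=> i j ij; rewrite covarianceE ?Lfun2_mul_Lfun1//.
  have -> : ('E_P[(Y i * Y j)%R] = 'E_P[Y i] * 'E_P[Y j])%E.
    rewrite unlock; apply: integral_mul_indep => // A B mA mB.
    exact: mutually_independent_pair.
  by rewrite subee// fin_numM// expectation_fin_num.
- by move=> i w; exact: g0.
Qed.

(** * One-sided strong law by truncation *)

Lemma cvg_integral_min_nat d (T : measurableType d) (R : realType)
    (P : {measure set T -> \bar R}) (f : T -> R) :
    measurable_fun setT f -> (forall x, 0 <= f x) ->
  (\int[P]_w (Num.min (f w) k%:R)%:E @[k --> \oo] --> \int[P]_w (f w)%:E)%E.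
Proof.
move=> mf f0.
pose h k w : \bar R := (Num.min (f w) k%:R)%:E.
have -> : (\int[P]_w (f w)%:E = \int[P]_w (limn (h ^~ w)))%E.
  apply: eq_integral => w _; apply/esym/cvg_lim => //.
  apply: (@cvg_near_cst); near=> k; rewrite /h; congr EFin.
  by apply/min_idPl; near: k; exact: nbhs_infty_ger.
apply: cvg_monotone_convergence => // [k|k w _|w _ k l kl].
- by apply/measurable_EFinP; apply: measurable_minr.
- by rewrite lee_fin le_min f0 ler0n.
- rewrite lee_fin le_min ge_min lexx/= ge_min.
  by apply/orP; right; rewrite ler_nat.
Unshelve. all: by end_near.
Qed.

(** By monotone convergence, min(g, k) already has mean above a for some k. It is bounded, so the
    strong law applies to it, and its averages are below those of g. *)
Lemma strong_law_lower d d' (T : measurableType d)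
    (T' : measurableType d') (R : realType) (P : probability T R)
    (P' : probability T' R) (Xs : nat -> {RV P >-> R}) (X : {RV P' >-> R})
    (g : R -> R) (a : R) :
    iid_copies Xs X -> measurable_fun setT g -> (forall x, 0 <= g x) ->
    (a%:E < \int[P']_w (g (X w))%:E)%E ->
  {ae P, forall w, \forall n \near \oo,
    a < n%:R^-1 * (\sum_(i < n) g (Xs i w))}.
Proof.
move=> iidX mg g0 ag.
have mgX : measurable_fun setT (g \o X) by exact: measurableT_comp.
have := @cvg_integral_min_nat _ _ _ P' _ mgX (fun w => g0 (X w)).
have /[swap]/[apply] : nbhs (\int[P']_w (g (X w))%:E)%E [set y | (a%:E < y)%E].
  by apply: open_nbhs_nbhs; split=> //; exact: open_ereal_gt_ereal.
move=> [k _ /(_ k (leqnn k))] /= ak.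
pose h x := Num.min (g x) k%:R.
have mh : measurable_fun setT h by exact: measurable_minr.
have h0 x : 0 <= h x by rewrite le_min g0 ler0n.
have hk x : h x <= k%:R by rewrite ge_min lexx orbT.
have ub c (f : T' -> R) : measurable_fun setT f -> (forall w, 0 <= f w <= c) ->
    (\int[P']_w (f w)%:E < +oo)%E.
  move=> mf fc; apply: (@le_lt_trans _ _ c%:E); last exact: ltry.
  rewrite -[leRHS]mule1 -(probability_setT P') -integral_cst//.
  apply: ge0_le_integral => //.
  - by move=> w _; rewrite lee_fin; case/andP: (fc w).
  - exact/measurable_EFinP.
  - by move=> w _; rewrite lee_fin; case/andP: (fc w).
have mhX : measurable_fun setT (h \o X) by exact: measurableT_comp.
have hfin : (\int[P']_w (h (X w))%:E < +oo)%E.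
  by apply: (ub k%:R) => // w; rewrite h0 hk.
have h2 : (\int[P']_w ((h (X w)) ^+ 2)%:E < +oo)%E.
  apply: (ub (k%:R ^+ 2)); first exact: measurable_funX.
  by move=> w; rewrite sqr_ge0/= lerXn2r// nnegrE.
apply: filterS (strong_law_iid_sqr iidX mh h0 h2) => w cvgh.
have ah : a < fine (\int[P']_w (h (X w))%:E)%E.
  rewrite -lte_fin fineK// ge0_fin_numE//.
  by apply: integral_ge0 => *; rewrite lee_fin.
move/(cvgr_gt _) : cvgh => /(_ _ ah); apply: filterS => n /lt_le_trans; apply.
rewrite ler_wpM2l ?invr_ge0// ler_sum// => i _.
by rewrite ge_min lexx.
Qed.

(** * Infinite second moment: the choice lambda = 0 *)

(** The bound is uniform in m because it is applied with m the sample mean, over which there is no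
    control here. *)
Lemma variance_about_gt (R : realType) (n : nat) (x : nat -> R)
    (m a b p B : R) :
    0 <= a -> 0 < b -> 0 < p ->
    p < n%:R^-1 * (\sum_(i < n) \1_(`[- a, a]%classic : set R) (x i)) ->
    2 * (B + (a + b) ^+ 2) < n%:R^-1 * (\sum_(i < n) x i ^+ 2) ->
    B <= b ^+ 2 * p ->
  B < n%:R^-1 * (\sum_(i < n) (x i - m) ^+ 2).
Proof.
move=> a0 b0 p0 avg1 avg2 Bbp.
have n0 : (0 < n)%N.
  rewrite lt0n; apply: contraL (lt_trans p0 avg1) => /eqP ->.
  by rewrite invr0 mul0r ltxx.
have nV0 : 0 < n%:R^-1 :> R by rewrite invr_gt0 ltr0n.
(* If |m| >= a + b, every sample point in [-a, a] lies at distance at least b from m and contributes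
   at least b^2. *)
have [mab|mab] := lerP (a + b) `|m|.
  apply: (le_lt_trans Bbp).
  have b20 : 0 < b ^+ 2 by rewrite exprn_gt0.
  have := avg1; rewrite -(ltr_pM2l b20) => /lt_le_trans; apply.
  rewrite mulrCA ler_pM2l// mulr_sumr ler_sum// => i _.
  rewrite indicE; have [|_] := boolP (x i \in _); last by rewrite mulr0 sqr_ge0.
  rewrite inE/= in_itv/= -ler_norml mulr1 => xa.
  rewrite -[leRHS]real_normK ?num_real// lerXn2r ?nnegrE// ?(ltW b0)//.
  by have := lerB_dist m (x i); rewrite distrC; lra.
have mab2 : m ^+ 2 <= (a + b) ^+ 2.
  by rewrite -real_normK ?num_real// lerXn2r ?nnegrE ?(ltW mab)//; lra.
(* For bounded m, (x - m)^2 >= x^2 / 2 - m^2, the difference being (x - 2 m)^2 / 2. This explains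
   the factor 2 and the term (a + b)^2 in the hypothesis. *)
apply: (@lt_le_trans _ _ (n%:R^-1 * (\sum_(i < n) (x i ^+ 2 / 2 - m ^+ 2)))).
  rewrite sumrB -mulr_suml mulrBr sumr_const card_ord -[m ^+ 2 *+ n]mulr_natl.
  by rewrite mulKf ?gt_eqF ?ltr0n// mulrA; lra.
rewrite ler_pM2l// ler_sum// => i _.
by have := sqr_ge0 (x i - 2 * m); nra.
Qed.

Lemma ae_variance_gt d d' (T : measurableType d)
    (T' : measurableType d') (R : realType) (P : probability T R)
    (P' : probability T' R) (Xs : nat -> {RV P >-> R}) (X : {RV P' >-> R})
    (B : R) :
    iid_copies Xs X -> (\int[P']_w (X w ^+ 2)%:E = +oo)%E ->
  {ae P, forall w, \forall n \near \oo, B < Ln n (fun i => Xs i w) 0}.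
Proof.
move=> iidX X2.
pose I (k : nat) : set R := `[- k%:R, k%:R]%classic.
have mI k : measurable (I k) by exact: measurable_itv.
(* The intervals [-k, k] exhaust the line, so they cannot all have probability zero. *)
have [k Pk] : exists k, (0 < P' (X @^-1` I k))%E.
  apply: contrapT => /forallNP Pk0.
  suff : P'.-negligible setT.
    move/(negligibleP _ measurableT)/(etrans (esym (probability_setT P'))).
    by move/eqP; rewrite onee_eq0.
  have -> : [set: T'] = \bigcup_k (X @^-1` I k).
    apply/esym; rewrite -subTset => w _; exists (Num.truncn `|X w|).+1 => //=.
    by rewrite /I/= in_itv/= -ler_norml ltW// truncnS_gt.
  apply: negligible_bigcup => k; apply/negligibleP.
    exact: measurable_funPTI.
  by apply/eqP; have /negP := Pk0 k; rewrite lt0e measure_ge0 andbT negbK.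
(* Halving leaves the strict inequality that the one-sided strong law requires. *)
pose p := fine (P' (X @^-1` I k)) / 2.
have Pfin : P' (X @^-1` I k) \is a fin_num.
  by apply: fin_num_measure; exact: measurable_funPTI.
have p0 : 0 < p by rewrite divr_gt0// fine_gt0// Pk ltey_eq Pfin.
have p1 : (p%:E < \int[P']_w (\1_(I k) (X w))%:E)%E.
  rewrite (_ : (\int[P']_w _)%E = P' (X @^-1` I k)); last first.
    rewrite -(expectation_indic P' (measurable_funPTI X (mI k))) unlock.
    by apply: eq_integral.
  rewrite -[ltRHS]fineK// lte_fin /p ltr_pdivrMr// ltr_pMr ?ltr1n// fine_gt0//.
  by rewrite Pk ltey_eq Pfin.
(* As b >= 1, b^2 p >= (b - 1) p = |B|. *)
pose b := `|B| / p + 1.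
have b1 : 1 <= b by rewrite lerDr divr_ge0// ltW.
have Bbp : B <= b ^+ 2 * p.
  apply: (le_trans (ler_norm B)).
  have -> : `|B| = (b - 1) * p by rewrite addrK divfK// gt_eqF.
  by rewrite ler_pM2r//; nra.
have mind : measurable_fun setT (\1_(I k) : R -> R) by exact: measurable_indic.
have ind0 x : 0 <= \1_(I k) x :> R by rewrite indicE ler0n.
have ae1 := strong_law_lower iidX mind ind0 p1.
have msq : measurable_fun setT (fun x : R => x ^+ 2) by exact: exprn_measurable.
have sqX : ((2 * (B + (k%:R + b) ^+ 2))%:E < \int[P']_w ((X w) ^+ 2)%:E)%E.
  by rewrite X2 ltry.
have ae2 := strong_law_lower iidX msq (fun x => sqr_ge0 x) sqX.
apply: filterS2 ae1 ae2 => w near1 near2.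
apply: filterS2 near1 near2 => n avg1 avg2.
rewrite /Ln eqxx.
apply: (@variance_about_gt _ n (fun i => Xs i w) _ k%:R b p B) => //.
exact: lt_le_trans b1.
Qed.

(** * Finite second moment: a nonzero lambda *)

(** The strong law at hand is for nonnegative variables; it is applied to the positive and negative
    parts, whose squares are at most x^2. *)
Lemma strong_law_sample_mean d d' (T : measurableType d)
    (T' : measurableType d') (R : realType) (P : probability T R)
    (P' : probability T' R) (Xs : nat -> {RV P >-> R}) (X : {RV P' >-> R}) :
    iid_copies Xs X -> (\int[P']_w (X w ^+ 2)%:E < +oo)%E ->
  {ae P, forall w, sample_mean n (fun i => Xs i w) @[n --> \oo] -->
    fine 'E_P'[X]%E}.
Proof.
move=> iidX X2.
have mX : measurable_fun setT X by [].
pose pos (x : R) := Num.max x 0; pose neg (x : R) := Num.max (- x) 0.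
have mpos : measurable_fun setT pos by exact: measurable_maxr.
have mneg : measurable_fun setT neg by apply: measurable_maxr.
have pos0 x : 0 <= pos x by rewrite le_max lexx orbT.
have neg0 x : 0 <= neg x by rewrite le_max lexx orbT.
have sqr_lty (h : R -> R) : measurable_fun setT h ->
    (forall x, h x ^+ 2 <= x ^+ 2) -> (\int[P']_w (h (X w) ^+ 2)%:E < +oo)%E.
  move=> mh hx; apply: le_lt_trans X2; apply: ge0_le_integral => //.
  - by move=> w _; rewrite lee_fin sqr_ge0.
  - by apply/measurable_EFinP; apply: measurable_funX; exact: measurableT_comp.
  - by apply/measurable_EFinP; exact: measurable_funX.
  - by move=> w _; rewrite lee_fin.
have pos2 x : pos x ^+ 2 <= x ^+ 2.
  by rewrite /pos maxEle; case: ifP; rewrite ?expr0n/= ?sqr_ge0.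
have neg2 x : neg x ^+ 2 <= x ^+ 2.
  by rewrite /neg maxEle; case: ifP; rewrite ?expr0n/= ?sqr_ge0 ?sqrrN.
have aepos := strong_law_iid_sqr iidX mpos pos0 (sqr_lty _ mpos pos2).
have aeneg := strong_law_iid_sqr iidX mneg neg0 (sqr_lty _ mneg neg2).
have Lfun1 (h : R -> R) : measurable_fun setT h ->
    (forall x, h x ^+ 2 <= x ^+ 2) -> h \o X \in Lfun P' 1.
  move=> mh hx; apply: (Lfun_subset12 (fin_num_measure P' _ measurableT)).
  apply: measurable_sqr_Lfun2; first exact: measurableT_comp.
  exact: sqr_lty.
have posneg x : x = pos x - neg x.
  by rewrite /pos /neg !maxEle; do 2 case: ifP; lra.
have -> : fine 'E_P'[X]%E = fine (\int[P']_w (pos (X w))%:E)%E -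
                           fine (\int[P']_w (neg (X w))%:E)%E.
  have -> : 'E_P'[X]%E = 'E_P'[(pos \o X) \- (neg \o X)]%E.
    by congr expectation; apply/funext => w /=; exact: posneg.
  rewrite expectationB ?Lfun1// fineB ?expectation_fin_num ?Lfun1//.
  by rewrite unlock.
apply: filterS2 aepos aeneg => w cpos cneg.
rewrite (_ : (fun n => _) = fun n =>
    n%:R^-1 * (\sum_(i < n) pos (Xs i w)) -
    n%:R^-1 * (\sum_(i < n) neg (Xs i w))); first exact: cvgB.
apply/funext => n; rewrite /sample_mean -mulrBr -sumrB.
by congr (_ * _); apply: eq_bigr => i _; exact: posneg.
Qed.

(** At lambda = 0 both sides equal 1, so a strict inequality rules that value out. An infinite
    moment generating function beats every xi2. *)
Lemma non_sub_gaussian_mmt_gt d (T : measurableType d) (R : realType)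
    (P : probability T R) (X : T -> R) (xi2 : R) :
    non_sub_gaussian P X -> 0 < xi2 ->
  exists2 lambda : R, lambda != 0 &
    ((expR (lambda ^+ 2 * xi2 / 2))%:E < 'M_P X lambda)%E.
Proof.
move=> nsg xi20.
suff [l Ml] : exists l, ((expR (l ^+ 2 * xi2 / 2))%:E < 'M_P X l)%E.
  exists l => //; apply: contraTneq Ml => ->.
  rewrite expr0n/= mul0r mul0r expR0 /mmt_gen_fun.
  have -> : expR \o 0 \o* X = cst 1.
    by apply/funext => w /=; rewrite mulr0 expR0.
  by rewrite expectation_cst ltxx.
case: nsg => [[l Ml]|]; last by apply.
by exists l; rewrite Ml ltry.
Qed.

(** The strong law handles exponentials centered at a fixed m, while [Ln] centers at the sample
    mean. The two averages differ by the factor exp (lambda (m - sample mean)), close to 1 when the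
    sample mean is close to m. *)
Lemma Ln_gt (R : realType) (n : nat) (x : nat -> R) (m lambda r a B : R) :
    lambda != 0 -> expR (lambda ^+ 2 * B / 2) = r ->
    a < n%:R^-1 * (\sum_(i < n) expR ((x i - m) * lambda)) ->
    r < expR (lambda * (m - sample_mean n x)) * a ->
  B < Ln n x lambda.
Proof.
move=> l0 rE avg ra; rewrite /Ln (negPf l0).
have l20 : 0 < 2 / lambda ^+ 2 by rewrite divr_gt0// exprn_even_gt0.
rewrite -ltr_pdivrMl// invf_div -ltr_expR.
have -> : n%:R^-1 * (\sum_(i < n) expR (lambda * (x i - sample_mean n x))) =
    expR (lambda * (m - sample_mean n x)) *
    (n%:R^-1 * (\sum_(i < n) expR ((x i - m) * lambda))).
  rewrite [RHS]mulrCA; congr (_ * _); rewrite mulr_sumr; apply: eq_bigr => i _.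
  by rewrite -expRD; congr expR; ring.
have lt_r : r < expR (lambda * (m - sample_mean n x)) *
    (n%:R^-1 * (\sum_(i < n) expR ((x i - m) * lambda))).
  by apply: (lt_trans ra); rewrite ltr_pM2l// expR_gt0.
rewrite lnK ?posrE; last by apply: lt_trans lt_r; rewrite -rE expR_gt0.
by rewrite mulrAC rE.
Qed.

(** The gap between r and a will absorb that factor, which is only close to 1. *)
Lemma lt_EFin_dense (R : realType) (r : R) (y : \bar R) :
  (r%:E < y)%E -> exists2 a : R, r < a & (a%:E < y)%E.
Proof.
case: y => [s|_|//]; last by exists (r + 1); rewrite ?ltrDl ?ltry.
by rewrite lte_fin => rs; exists ((r + s) / 2); rewrite ?lte_fin ?midf_lt.
Qed.

(** Here lambda is chosen before the sample point, from the law of X and B alone, so it eventually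
    falls within any truncation levels tending to infinity. *)
Lemma ae_Ln_gt d d' (T : measurableType d)
    (T' : measurableType d') (R : realType) (P : probability T R)
    (P' : probability T' R) (Xs : nat -> {RV P >-> R}) (X : {RV P' >-> R})
    (B : R) :
    iid_copies Xs X -> non_sub_gaussian P' (centered P' X) -> 0 < B ->
  exists lambda : R,
    {ae P, forall w, \forall n \near \oo, B < Ln n (fun i => Xs i w) lambda}.
Proof.
move=> iidX nsg B0.
have [X2|] := ltP (\int[P']_w (X w ^+ 2)%:E)%E +oo%E; last first.
  by rewrite leye_eq => /eqP X2; exists 0; exact: ae_variance_gt iidX X2.
have [lambda l0] := non_sub_gaussian_mmt_gt nsg B0.
pose m := fine 'E_P'[X]%E.
rewrite /mmt_gen_fun unlock /centered -/m => /lt_EFin_dense[a ra aM].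
exists lambda.
pose g (x : R) : R := expR ((x - m) * lambda).
have mg : measurable_fun setT g.
  apply: measurableT_comp => //; apply: measurable_funM => //.
  exact: measurable_funB.
have ae1 := strong_law_lower iidX mg (fun x => expR_ge0 _) aM.
have ae2 := strong_law_sample_mean iidX X2.
apply: filterS2 ae1 ae2 => w near1 cvgm.
(* The sample mean tends to m, so the recentering factor tends to 1 and the product eventually
   exceeds r < a. *)
have cvgr : expR (lambda * (m - sample_mean n (fun i => Xs i w))) * a
    @[n --> \oo] --> a.
  rewrite -[X in _ --> X]mul1r -expR0 -(mulr0 lambda) -(subrr m).
  apply: cvgM; last exact: cvg_cst.
  apply: continuous_cvg; first exact: continuous_expR.
  apply: cvgM; first exact: cvg_cst.
  by apply: cvgB => //; exact: cvg_cst.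
apply: filterS2 near1 (cvgr_gt _ cvgr _ ra) => n avg ran.
exact: (@Ln_gt _ n (fun i => Xs i w) m lambda _ a B l0 erefl).
Qed.

(** * Divergence of the estimator *)

Lemma xi2_hat_ge (R : realType) (c : R) (n : nat) (x : nat -> R) (lambda : R) :
  `|lambda| <= c -> ((Ln n x lambda)%:E <= xi2_hat c n x)%E.
Proof. by move=> lc; apply: ereal_sup_ubound; exists lambda. Qed.

(* The condition hcX is void for a centered X; for an X with nonzero mean it
   excludes the case where only the mean makes X non-sub-Gaussian, such as
   X = 1, for which the estimator is identically 0. *)
Theorem proposition11 (R : realType)
    (d0 : measure_display) (T0 : measurableType d0) (P0 : probability T0 R)
    (X : {RV P0 >-> R})
    (hX : non_sub_gaussian P0 X)
    (hcX : ('E_P0[X])%E <> 0%E -> non_sub_gaussian P0 (centered P0 X))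
    (d : measure_display) (T : measurableType d) (P : probability T R)
    (Xs : nat -> {RV P >-> R})
    (hXs : iid_copies Xs X)
    (C : nat -> R)
    (hCpos : forall n, (0 < n)%N -> 0 < C n)
    (hC : C n @[n --> \oo] --> +oo) :
  {ae P, forall w,
    xi2_hat (C n) n (fun i => Xs i w) @[n --> \oo] --> +oo%E}.
Proof.
have cX : non_sub_gaussian P0 (centered P0 X).
  have [EX0|/hcX//] := pselect ('E_P0[X] = 0)%E.
  rewrite /centered EX0/= (_ : _ \- _ = X)//.
  by apply/funext => w /=; rewrite subr0.
(* Countably many levels keep the exceptional set null. They are k + 1 because [ae_Ln_gt] asks for a
   positive bound, and they are cofinal in the reals. *)
have : {ae P, forall w, forall k : nat, \forall n \near \oo,
    ((k.+1%:R : R)%:E < xi2_hat (C n) n (fun i => Xs i w))%E}.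
  apply: ae_foralln => k.
  have [lambda] := ae_Ln_gt hXs cX (ltr0Sn R k).
  apply: filterS => w; move/cvgryPge/(_ `|lambda|) : hC.
  apply: filterS2 => n lC kL.
  by apply: lt_le_trans (xi2_hat_ge _ _ lC); rewrite lte_fin.
apply: filterS => w near_k; apply/cvgeyPgt => A.
apply: filterS (near_k (Num.truncn A)) => n; apply: lt_trans.
by rewrite lte_fin truncnS_gt.
Qed.
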